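(* Let $\Sigma_1,\Sigma_2$ be positive definite $n\times n$ real matrices and for $\lambda>0$ let $$\Sigma_\lambda:=\Sigma_1^{1/2}(\Sigma_1^{1/2}\Sigma_2\Sigma_1^{1/2}+\lambda^2I)^{1/2}\Sigma_1^{-1/2}-\lambda I.$$ Let $\nu_{\lambda,1}\leq\nu_{\lambda,2}\leq\cdots\leq\nu_{\lambda,n}$ be the eigenvalues of $\Sigma_{\lambda}$. Then for every $i\in\{1,2,\dots,n\}$, $\nu_{\lambda,i}$ monotonically decreases with $\lambda$.
   Context: $A^{1/2}$ denotes the positive definite square root of a positive definite matrix and $I$ the $n\times n$ identity. ($\Sigma_\lambda$ is the cross-covariance block of the optimal coupling of $\mathcal{N}(\mu_1,\Sigma_1)$ and $\mathcal{N}(\mu_2,\Sigma_2)$ for optimal transport with squared Euclidean cost and regularizer $-4\lambda$ times Shannon entropy.) *)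

(* Defs.v *)
From mathcomp Require Import all_boot all_order all_algebra.
From mathcomp Require Import boolp classical_sets reals.

Set Implicit Arguments.
Unset Strict Implicit.
Unset Printing Implicit Defensive.

Import Order.TTheory GRing.Theory Num.Theory.
Local Open Scope ring_scope.
Local Open Scope classical_set_scope.

Definition posdefmx (R : realType) (n : nat) (A : 'M[R]_n) : Prop :=
  A^T = A /\ forall x : 'cV[R]_n, x != 0 -> 0 < (x^T *m A *m x) 0 0.

Definition is_sqrtmx (R : realType) (n : nat) (A S : 'M[R]_n) : Prop :=
  posdefmx S /\ S *m S = A.

(* The value 0 is taken only when A has no positive definite square root, i.e.
   when A is not positive definite. Uniqueness of the root is sqrtmx_unique. *)
Definition sqrtmx (R : realType) (n : nat) (A : 'M[R]_n) : 'M[R]_n :=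
  xget 0 [set S | is_sqrtmx A S].

(* Eigenvalues are repeated according to algebraic multiplicity, so a tuple as
   below exists only if the characteristic polynomial splits over R. *)
Definition ordered_eigenvalues (R : realType) (n : nat) (A : 'M[R]_n)
    (s : n.-tuple R) : Prop :=
  sorted <=%R s /\ char_poly A = \prod_(x <- s) ('X - x%:P).

(* The tuple of zeros is the default for matrices whose characteristic
   polynomial does not split over R. Uniqueness is eigvals_unique. *)
Definition eigvals (R : realType) (n : nat) (A : 'M[R]_n) : n.-tuple R :=
  xget [tuple of nseq n 0] [set s | ordered_eigenvalues A s].

Definition Sigma (R : realType) (n : nat) (S1 S2 : 'M[R]_n) (l : R) : 'M[R]_n :=
  sqrtmx S1 *m sqrtmx (sqrtmx S1 *m S2 *m sqrtmx S1 + (l ^+ 2)%:M)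
    *m invmx (sqrtmx S1) - l%:M.

Lemma eigvals_unique (R : realType) (n : nat) (A : 'M[R]_n) (s : n.-tuple R) :
  ordered_eigenvalues A s -> eigvals A = s.
Proof.
move=> sA; apply: (xget_unique _ (P := [set s | ordered_eigenvalues A s])) => //.
move=> t [tsort tA]; case: sA => ssort sA; apply/val_inj.
apply: (le_sorted_eq tsort ssort).
by apply: prod_XsubC_eq; rewrite -tA -sA.
Qed.

Lemma posdefmx_trace (R : realType) (n : nat) (S D : 'M[R]_n) :
  posdefmx S -> 0 <= \tr (D^T *m S *m D) ?= iff (D == 0).
Proof.
move=> [_ Spos].
have E j : (D^T *m S *m D) j j = ((col j D)^T *m S *m col j D) 0 0.
  rewrite tr_col -row_mul [in LHS]mxE [in RHS]mxE; apply: eq_bigr => k _.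
  by rewrite [col j D _ _]mxE [row j _ _ _]mxE.
have ge0 j : 0 <= (D^T *m S *m D) j j.
  rewrite E; have [->|/Spos/ltW//] := eqVneq (col j D) 0.
  by rewrite mulmx0 mxE.
split; first exact: sumr_ge0.
apply/idP/eqP => [|->]; last by rewrite mulmx0 mxtrace0.
rewrite eq_sym psumr_eq0 => [/allP t0|j _]; last exact: ge0.
apply/matrixP => i j; rewrite mxE.
have := t0 j (mem_index_enum _); rewrite E implyTb => /eqP E0.
have [/matrixP/(_ i 0)|/Spos] := eqVneq (col j D) 0; first by rewrite !mxE.
by rewrite E0 ltxx.
Qed.

Lemma sqrtmx_unique (R : realType) (n : nat) (A S : 'M[R]_n) :
  is_sqrtmx A S -> sqrtmx A = S.
Proof.
move=> sA; apply: (xget_unique _ (P := [set S | is_sqrtmx A S])) => //.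
move=> T [Tpos TA]; case: sA => Spos SA; apply/eqP; rewrite -subr_eq0.
set D := T - S.
have DT : D^T = D by rewrite linearB /= Spos.1 Tpos.1.
have [hT eT] := posdefmx_trace D Tpos.
have [hS _] := posdefmx_trace D Spos.
have H : \tr (D^T *m T *m D) + \tr (D^T *m S *m D) = 0.
  rewrite DT -(mulmxA D T) (mxtrace_mulC D (T *m D)) -mxtraceD -mulmxDl.
  rewrite [_ *m D + _](_ : _ = 0) ?mul0mx ?mxtrace0 //.
  by rewrite mulmxBr mulmxBl TA SA addrA subrK subrr.
by rewrite -eT eq_sym; move/eqP: H; rewrite paddr_eq0 // => /andP[].
Qed.

(* Main.v *)
Require Import Defs.
From mathcomp Require Import all_boot all_order all_algebra.
From mathcomp Require Import boolp classical_sets reals.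
From mathcomp Require Import complex.

Set Implicit Arguments.
Unset Strict Implicit.
Unset Printing Implicit Defensive.

Import Order.TTheory GRing.Theory Num.Theory.
Local Open Scope ring_scope.

(** Put [M := sqrtmx S1 *m S2 *m sqrtmx S1], a positive definite matrix. The
    matrix [Sigma S1 S2 l] is conjugate, by [sqrtmx S1], to
    [sqrtmx (M + l^2 I) - l I], which is the function
    [x |-> Num.sqrt (x + l ^+ 2) - l] applied to [M]. Hence its eigenvalues are
    the values of this function at the eigenvalues of [M], a matrix that does
    not depend on [l]; and as the function is increasing in [x], it carries the
    ordered eigenvalues of [M] to the ordered eigenvalues of [Sigma S1 S2 l]
    ([eigvals_Sigma]). For a fixed [x > 0] the function is strictly decreasing
    in [l > 0], because it is equal to [x / (Num.sqrt (x + l ^+ 2) + l)]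
    ([shifted_sqrt_decr]).

    Since [sqrtmx] and [eigvals] are choices that return a default value when
    there is nothing to choose, the work is in exhibiting the root and the
    spectrum. Both come from the diagonalization of a real symmetric matrix
    [A = invmx P *m diag_mx d *m P] ([real_symmetric_diag]). A function [f] is
    applied to [A] by applying it to the entries of [d]; the result [fun_mx]
    is symmetric, and is positive definite when [f] is positive on the
    spectrum ([posdefmx_fun]), although [P] is any invertible matrix, not
    necessarily orthogonal. *)

(** * Conjugation, congruence and positive definiteness *)

Lemma char_poly_conj (F : fieldType) (n : nat) (P A : 'M[F]_n) :
  P \in unitmx -> char_poly (invmx P *m A *m P) = char_poly A.
Proof.
move=> Pu; rewrite /char_poly.
have PP : map_mx polyC (invmx P) *m map_mx polyC P = 1%:M.
  by rewrite -map_mxM mulVmx // map_mx1.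
have -> : char_poly_mx (invmx P *m A *m P)
    = map_mx polyC (invmx P) *m char_poly_mx A *m map_mx polyC P.
  rewrite /char_poly_mx mulmxBr mulmxBl !map_mxM scalar_mxC.
  by rewrite -!mulmxA PP mulmx1.
by rewrite !det_mulmx mulrAC -det_mulmx PP det1 mul1r.
Qed.

Lemma posdefmx_unit (R : realType) (n : nat) (A : 'M[R]_n) :
  posdefmx A -> A \in unitmx.
Proof.
move=> [Asym Apos]; rewrite -row_free_unit -kermx_eq0.
apply/eqP/row_matrixP => i; rewrite row0; apply/eqP.
apply: contraT => vN0; have := Apos (row i (kermx A))^T.
rewrite trmx_eq0 => /(_ vN0).
by rewrite trmxK -row_mul mulmx_ker row0 mul0mx mxE ltxx.
Qed.

Lemma posdefmx1 (R : realType) (n : nat) : posdefmx (1%:M : 'M[R]_n).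
Proof.
split=> [|x xN0]; first exact: trmx1.
rewrite mulmx1 mxE lt0r sumr_ge0 => [|i _]; last by rewrite mxE -expr2 sqr_ge0.
rewrite andbT psumr_eq0 => [|i _]; last by rewrite mxE -expr2 sqr_ge0.
apply: contra xN0 => /allP x0; apply/eqP/matrixP => i j; rewrite ord1 [RHS]mxE.
have := x0 i (mem_index_enum _).
by rewrite implyTb mxE mulf_eq0 orbb => /eqP.
Qed.

Lemma posdefmx_congr (R : realType) (n : nat) (T A : 'M[R]_n) :
  T \in unitmx -> posdefmx A -> posdefmx (T^T *m A *m T).
Proof.
move=> Tu [Asym Apos]; split=> [|x xN0].
  by rewrite !trmx_mul trmxK Asym mulmxA.
have TxN0 : T *m x != 0.
  by apply: contra xN0 => /eqP Tx0; rewrite -(mulKmx Tu x) Tx0 mulmx0.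
by have := Apos _ TxN0; rewrite trmx_mul !mulmxA.
Qed.

(** * Diagonalization of real symmetric matrices *)

(** Over the complex numbers the matrix is Hermitian, so it is diagonalizable
    with real eigenvalues; and two real matrices that are similar over the
    complex numbers are similar over the reals. *)
Lemma real_symmetric_diag (R : realType) (n : nat) (A : 'M[R]_n) :
  A^T = A ->
  exists P : 'M[R]_n, exists d : 'rV[R]_n,
    P \in unitmx /\ A = invmx P *m diag_mx d *m P.
Proof.
move=> Asym; pose c := @real_complex R.
have creal m k (B : 'M[R]_(m, k)) : map_mx c B \is a mxOver Num.real.
  by apply/mxOverP => i j; rewrite mxE; apply/complex_realP; exists (B i j).
have realc m k (B : 'M[R[i]]_(m, k)) : B \is a mxOver Num.real ->
    exists B' : 'M[R]_(m, k), B = map_mx c B'.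
  move=> /mxOverP Breal; exists (map_mx (@complex.Re R) B).
  by apply/matrixP => i j; rewrite !mxE /c /= RRe_real.
have Aherm : map_mx c A \is hermsymmx.
  apply: realsym_hermsym => //; apply/is_hermitianmxP.
  by rewrite expr0 scale1r map_mx_id // map_trmx Asym.
have [d dE] := realc _ _ _ (hermitian_spectral_diag_real Aherm).
have /orthomx_spectralP AE := hermitian_normalmx Aherm.
have sim : similar_in unitmx (map_mx c A) (map_mx c (diag_mx d)).
  exists (spectralmx (map_mx c A)); first exact: spectral_unit.
  apply/simmxP; first exact: spectral_unit.
  rewrite {2}AE dE map_diag_mx !mulmxA mulmxV ?mul1mx //.
  exact: spectral_unit.
have [Q /= /andP[Qreal Qu]] := real_similar sim (creal _ _ _) (creal _ _ _).
move=> /(simmxP Qu) QE.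
have [P PE] := realc _ _ _ Qreal.
have Pu : P \in unitmx by rewrite -(map_unitmx c) -PE.
exists P, d; split=> //.
have PA : P *m A = diag_mx d *m P.
  by apply: (map_mx_inj (f := c)); rewrite !map_mxM -PE QE.
by rewrite -mulmxA -PA mulKmx.
Qed.

(** * Functions of a diagonalized matrix *)

Definition fun_mx (R : realType) (n : nat) (P : 'M[R]_n) (f : R -> R)
    (d : 'rV[R]_n) : 'M[R]_n :=
  invmx P *m diag_mx (map_mx f d) *m P.

Section FunMx.
Context {R : realType} {n : nat}.
Context (P A : 'M[R]_n) (d : 'rV[R]_n).
Context (Pu : P \in unitmx) (AE : A = invmx P *m diag_mx d *m P).

Lemma fun_mxM (f g : R -> R) :
  fun_mx P f d *m fun_mx P g d = fun_mx P (fun x => f x * g x) d.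
Proof.
rewrite /fun_mx !mulmxA mulmxK // -[in LHS](mulmxA (invmx P)) mulmx_diag.
by congr (_ *m diag_mx _ *m _); apply/matrixP => i j; rewrite !mxE ord1.
Qed.

Lemma fun_mx_shift (f : R -> R) (a : R) :
  fun_mx P (fun x => f x + a) d = fun_mx P f d + a%:M.
Proof.
have -> : a%:M = invmx P *m a%:M *m P.
  by rewrite scalar_mxC mulmxKV.
rewrite /fun_mx -mulmxDl -mulmxDr; congr (_ *m _ *m _).
by apply/matrixP => i j; rewrite !mxE -mulrnDl.
Qed.

Lemma fun_mx_char_poly (f : R -> R) :
  char_poly (fun_mx P f d) = \prod_(i < n) ('X - (f (d 0 i))%:P).
Proof.
rewrite char_poly_conj // char_poly_trig ?diag_mx_is_trig //.
by apply: eq_bigr => i _; rewrite !mxE eqxx.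
Qed.

(** The symmetry of [A] says that [diag_mx d] commutes with [P *m P^T], that is,
    that [P *m P^T] has no nonzero entry outside the blocks on which [d] is
    constant; then the diagonal matrix of the [f (d 0 i)] commutes with it
    too, which gives back the symmetry of the function of [A]. *)
Lemma fun_mx_sym (f : R -> R) : A^T = A -> (fun_mx P f d)^T = fun_mx P f d.
Proof.
have PTu : P^T \in unitmx by rewrite unitmx_tr.
have symE (e : 'rV[R]_n) :
    (invmx P *m diag_mx e *m P)^T = invmx P *m diag_mx e *m P <->
    P *m P^T *m diag_mx e = diag_mx e *m (P *m P^T).
  rewrite !trmx_mul tr_diag_mx trmx_inv mulmxA; split=> eE.
    have := congr1 (fun X => P *m X *m P^T) eE.
    by rewrite -!mulmxA mulVmx // mulmx1 (mulmxA P (invmx P)) mulmxV ?mul1mx.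
  apply: (can_inj (mulKmx Pu)); apply: (can_inj (mulmxK PTu)).
  rewrite -!mulmxA mulVmx // mulmx1 (mulmxA P (invmx P)) mulmxV ?mul1mx //.
  by rewrite mulmxA.
rewrite {1 2}AE => /symE dG; apply/symE/matrixP => i j.
have := congr1 (fun X : 'M_n => X i j) dG.
rewrite !mul_mx_diag !mul_diag_mx !mxE.
rewrite [d 0 i * _]mulrC => /eqP; rewrite -subr_eq0 -mulrBr mulf_eq0.
case/orP => [/eqP->|]; first by rewrite mulr0 mul0r.
by rewrite subr_eq0 => /eqP->; rewrite mulrC.
Qed.

(** The matrix is the square of [fun_mx P (Num.sqrt \o f) d], which is symmetric
    and invertible: so it is congruent to the identity. *)
Lemma posdefmx_fun (f : R -> R) :
  A^T = A -> (forall i, 0 < f (d 0 i)) -> posdefmx (fun_mx P f d).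
Proof.
move=> Asym fpos; pose T := fun_mx P (Num.sqrt \o f) d.
have TE : fun_mx P f d = T^T *m 1%:M *m T.
  rewrite (fun_mx_sym _ Asym) mulmx1 fun_mxM /fun_mx.
  congr (_ *m diag_mx _ *m _); apply/matrixP => i j.
  by rewrite !mxE ord1 /= -expr2 sqr_sqrtr ?ltW.
rewrite TE; apply: posdefmx_congr (posdefmx1 _ _).
rewrite !unitmx_mul unitmx_inv Pu andbT /= unitmxE det_diag unitfE.
by apply/prodf_neq0 => i _; rewrite mxE /= gt_eqF // sqrtr_gt0.
Qed.

(** Row [i] of [P] is an eigenvector for [d 0 i], and the quadratic form of [A]
    takes there the value [d 0 i] times the squared norm of the row. *)
Lemma posdefmx_diag_gt0 : posdefmx A -> forall i, 0 < d 0 i.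
Proof.
move=> [_ Apos] i; pose v := row i P.
have vA : v *m A = d 0 i *: v.
  by rewrite AE -row_mul !mulmxA mulmxV // mul1mx row_mul row_diag_mx -scalemxAl
    -rowE.
have vN0 : v^T != 0.
  rewrite trmx_eq0; apply: contraL Pu => /eqP v0.
  apply/negP => Pu'; have := congr1 (mulmx^~ (invmx P)) v0.
  rewrite /v -row_mul mulmxV // mul0mx row1 => /matrixP/(_ 0 i)/eqP.
  by rewrite !mxE !eqxx oner_eq0.
have := Apos _ vN0; rewrite trmxK vA -scalemxAl mxE pmulr_lgt0 //.
by have := (posdefmx1 R n).2 _ vN0; rewrite trmxK mulmx1.
Qed.

Lemma is_sqrtmx_shift (b : R) : posdefmx A -> 0 <= b ->
  is_sqrtmx (A + b%:M) (fun_mx P (fun x => Num.sqrt (x + b)) d).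
Proof.
move=> Apos b0; have d0 := posdefmx_diag_gt0 Apos; split.
  apply: posdefmx_fun => [|i]; first exact: Apos.1.
  by rewrite sqrtr_gt0 ltr_wpDr.
have -> : A = fun_mx P id d by rewrite /fun_mx map_mx_id.
rewrite -fun_mx_shift fun_mxM /fun_mx; congr (_ *m diag_mx _ *m _).
apply/matrixP => i j.
by rewrite !mxE ord1 -expr2 sqr_sqrtr // addr_ge0 // ltW.
Qed.

End FunMx.

Lemma sqrtmxP (R : realType) (n : nat) (A : 'M[R]_n) :
  posdefmx A -> is_sqrtmx A (sqrtmx A).
Proof.
move=> Apos; have [P [d [Pu AE]]] := real_symmetric_diag Apos.1.
have := is_sqrtmx_shift Pu AE Apos (lexx 0).
by rewrite raddf0 addr0 => rA; rewrite (sqrtmx_unique rA).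
Qed.

(** * The eigenvalues of Sigma *)

Definition shifted_sqrt (R : realType) (l x : R) : R :=
  Num.sqrt (x + l ^+ 2) - l.

Lemma shifted_sqrt_homo (R : realType) (l : R) :
  {homo shifted_sqrt l : x y / x <= y}.
Proof. by move=> x y xy; rewrite lerD2r ler_wsqrtr // lerD2r. Qed.

Lemma shifted_sqrtE (R : realType) (l x : R) : 0 < l -> 0 < x ->
  shifted_sqrt l x = x / (Num.sqrt (x + l ^+ 2) + l).
Proof.
move=> l0 x0; have q0 : 0 < Num.sqrt (x + l ^+ 2) + l.
  by rewrite ltr_wpDl ?sqrtr_ge0.
apply: (canRL (mulfK (lt0r_neq0 q0))); rewrite -subr_sqr sqr_sqrtr ?addrK //.
by rewrite addr_ge0 ?sqr_ge0 // ltW.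
Qed.

Lemma shifted_sqrt_decr (R : realType) (x l1 l2 : R) : 0 < x -> 0 < l1 ->
  l1 < l2 -> shifted_sqrt l2 x < shifted_sqrt l1 x.
Proof.
move=> x0 l10 l12; have l20 := lt_trans l10 l12.
have den_pos l : 0 < l -> Num.sqrt (x + l ^+ 2) + l \is Num.pos.
  by move=> l0; rewrite posrE ltr_wpDl ?sqrtr_ge0.
rewrite !shifted_sqrtE // ltr_pM2l // ltf_pV2 ?den_pos //.
apply: ler_ltD (l12); rewrite ler_wsqrtr // lerD2l.
by rewrite ler_pXn2r ?nnegrE ?(ltW l10) ?(ltW l20) ?(ltW l12).
Qed.

(** The tuple [s] is the ordered spectrum of
    [sqrtmx S1 *m S2 *m sqrtmx S1], common to all values of [l]. *)
Lemma eigvals_Sigma (R : realType) (n : nat) (S1 S2 : 'M[R]_n) :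
  posdefmx S1 -> posdefmx S2 ->
  exists2 s : n.-tuple R, (forall i, 0 < tnth s i) &
    forall l, eigvals (Sigma S1 S2 l) = map_tuple (shifted_sqrt l) s.
Proof.
move=> S1pos S2pos; set Q := sqrtmx S1.
have [Qpos _] : is_sqrtmx S1 Q := sqrtmxP S1pos.
have Qu := posdefmx_unit Qpos.
pose M := Q *m S2 *m Q.
have Mpos : posdefmx M.
  by rewrite /M -{1}Qpos.1; exact: posdefmx_congr.
have [P [d [Pu ME]]] := real_symmetric_diag Mpos.1.
have d0 := posdefmx_diag_gt0 Pu ME Mpos.
pose s := sort_tuple <=%R [tuple d 0 i | i < n].
exists s => [i|l].
  have : tnth s i \in [tuple d 0 i | i < n].
    by rewrite -(mem_sort <=%R) mem_tnth.
  by case/mapP => j _ ->; exact: d0.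
apply: eigvals_unique; split.
  apply: (homo_sorted (e := <=%R)); first exact: shifted_sqrt_homo.
  exact: sort_le_sorted.
rewrite /Sigma -/Q -/M (sqrtmx_unique (is_sqrtmx_shift Pu ME Mpos (sqr_ge0 l))).
(* [Sigma] is the conjugate by [Q] of the shifted function of [M]. *)
have -> : l%:M = Q *m l%:M *m invmx Q by rewrite scalar_mxC mulmxK.
rewrite -mulmxBl -mulmxBr -raddfN -fun_mx_shift //.
rewrite -{1}(invmxK Q) char_poly_conj ?unitmx_inv // fun_mx_char_poly //.
rewrite big_map (perm_big _ (permEl (perm_sort _ _))) /=.
by rewrite big_map big_enum.
Qed.

Theorem corollary3p3p1 (R : realType) (n : nat) (S1 S2 : 'M[R]_n)
    (S1pos : posdefmx S1) (S2pos : posdefmx S2) (i : 'I_n) (l1 l2 : R) :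
  0 < l1 -> l1 < l2 ->
  tnth (eigvals (Sigma S1 S2 l2)) i < tnth (eigvals (Sigma S1 S2 l1)) i.
Proof.
move=> l10 l12; have [s s0 sE] := eigvals_Sigma S1pos S2pos.
by rewrite !sE !tnth_map; exact: shifted_sqrt_decr.
Qed.
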